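(* For every integer $s \ge 4$ there is a constant $c_s > 0$ such that for every integer $k \ge 2$, \[ r(s,k) \ge c_s \frac{k^{s-2}}{(\log k)^{2s-6}}. \]
   Context: For positive integers $s,k$, the Ramsey number $r(s,k)$ is the minimum integer $n$ such that every graph on $n$ vertices contains a clique of size $s$ or an independent set of size $k$. $\log$ denotes the natural logarithm. *)

(* Defs.v *)
From mathcomp Require Import all_boot.
From Stdlib Require Import Reals ClassicalEpsilon.

Set Implicit Arguments.
Unset Strict Implicit.
Unset Printing Implicit Defensive.

Definition simple_graph (n : nat) (e : rel 'I_n) : Prop :=
  irreflexive e /\ symmetric e.

Definition is_clique (n : nat) (e : rel 'I_n) (S : {set 'I_n}) : Prop :=
  forall x y, x \in S -> y \in S -> x != y -> e x y.

Definition is_indep (n : nat) (e : rel 'I_n) (S : {set 'I_n}) : Prop :=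
  forall x y, x \in S -> y \in S -> ~~ e x y.

Definition ramsey_prop (s k n : nat) : Prop :=
  forall e : rel 'I_n, simple_graph e ->
    (exists S : {set 'I_n}, #|S| = s /\ is_clique e S) \/
    (exists S : {set 'I_n}, #|S| = k /\ is_indep e S).

Definition ramsey_propb (s k n : nat) : bool :=
  if excluded_middle_informative (ramsey_prop s k n) then true else false.

(* r(s,k): the least n with ramsey_prop s k n.  (Such n exists by Ramsey's
   theorem; the fallback value 0 is never used.) *)
Definition ramsey (s k : nat) : nat :=
  match excluded_middle_informative (exists n, ramsey_propb s k n) with
  | left H => ex_minn H
  | right _ => 0
  end.

(* Main.v *)
Require Import Defs.
From mathcomp Require Import all_boot all_order all_algebra.
From mathcomp Require Import finfield mxabelem.
From mathcomp Require Import zify ring.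

(** Let [F] be a field with [q] elements, [n = s - 1] and [V = F^n].  Attach to
    every vertex [i] a pair [(a_i, b_i)] of vectors with [a_i . b_i <> 0], and
    join [i < j] when [a_i . b_j = 0].  On a clique the matrix [(a_i . b_j)] is
    triangular with nonzero diagonal, and its rank is at most [n], so there is no
    clique of size [s].

    For random pairs, reveal a would-be independent set in increasing order and
    let [T] be the set of vectors orthogonal to none of the [a_i] seen so far; the
    next [b] must lie in [T].  Either [a] is orthogonal to a proportion at least
    [1/(2q)] of [T], so that [T] shrinks, which can happen only [O(q log q)] times;
    or [a] is one of the at most [4 q^(n+2) / |T|] exceptional vectors, and then the
    pair [(a, b)] is one of at most [4 q^(n+2)], a proportion [O(q^(2-n))] of all
    pairs.  Hence for [k >> q (log q)^2] a given [k]-set is independent with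
    probability [O(q^(2-n))^k], and a union bound allows [c k q^(n-2)] vertices.
    Powers of two provide a suitable [q] of order [k / (log k)^2]. *)

Set Implicit Arguments.
Unset Strict Implicit.
Unset Printing Implicit Defensive.

(** * Existence of Ramsey numbers *)

(** Erdős-Szekeres induction: inside [A], the neighbours or the non-neighbours of a vertex number at
    least half the threshold. Letting [A] vary keeps the vertex type fixed. *)
Lemma finite_ramsey (T : finType) (e : rel T) (s k : nat) (A : {set T}) :
  irreflexive e -> symmetric e -> 2 ^ (s + k) <= #|A| ->
  exists S : {set T}, S \subset A /\
   ((#|S| = s /\ forall x y, x \in S -> y \in S -> x != y -> e x y) \/
    (#|S| = k /\ forall x y, x \in S -> y \in S -> ~~ e x y)).
Proof.
move=> eI eS; elim: s k A => [|s IHs] k A.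
  by exists set0; rewrite sub0set cards0; split=> //; left; split=> // x y; rewrite inE.
elim: k A => [|k IHk] A.
  by exists set0; rewrite sub0set cards0; split=> //; right; split=> // x y; rewrite inE.
move=> leA; have /card_gt0P[x xA] : 0 < #|A| by apply: leq_trans leA; rewrite expn_gt0.
pose B := [set y in A | e x y]; pose C := [set y in A :\ x | ~~ e x y].
have cA : #|A| = (#|B| + #|C|).+1.
  rewrite (cardsD1 x A) xA add1n -(cardsID [set y | e x y] (A :\ x)); congr (_ + _).+1.
    apply: eq_card => y; rewrite !inE; case: (y =P x) => [->|_] //.
    by rewrite eI !andbF.
  by apply: eq_card => y; rewrite !inE andbC.
have [leB|ltB] := leqP (2 ^ (s + k.+1)) #|B|.
  have [S [SB [[cS clS]|[cS inS]]]] := IHs _ _ leB; last first.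
    exists S; split; last by right.
    by apply: subset_trans SB _; apply/subsetP => y; rewrite inE => /andP[].
  have xS : x \notin S by apply/negP => /(subsetP SB); rewrite inE eI andbF.
  exists (x |: S); split.
    rewrite subUset sub1set xA; apply: subset_trans SB _.
    by apply/subsetP => y; rewrite inE => /andP[].
  left; rewrite cardsU1 xS cS; split=> // y z.
  have eS' w : w \in S -> e x w by move=> /(subsetP SB); rewrite inE => /andP[].
  rewrite !inE => /predU1P[->|yS] /predU1P[->|zS]; rewrite ?eqxx //.
  - by move=> _; apply: eS'.
  - by move=> _; rewrite eS; apply: eS'.
  - exact: clS.
have leC : 2 ^ (s.+1 + k) <= #|C|.
  by move: leA ltB; rewrite cA addSn !addnS expnS addSn; lia.
have [S [SC [[cS clS]|[cS inS]]]] := IHk _ leC.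
  exists S; split; last by left.
  by apply: subset_trans SC _; apply/subsetP => y; rewrite !inE => /andP[/andP[]].
have xS : x \notin S by apply/negP => /(subsetP SC); rewrite !inE eqxx.
exists (x |: S); split.
  rewrite subUset sub1set xA; apply: subset_trans SC _.
  by apply/subsetP => y; rewrite !inE => /andP[/andP[]].
right; rewrite cardsU1 xS cS; split=> // y z.
have eS' w : w \in S -> ~~ e x w by move=> /(subsetP SC); rewrite inE => /andP[].
rewrite !inE => /predU1P[->|yS] /predU1P[->|zS]; rewrite ?eI //.
- exact: eS'.
- by rewrite eS; apply: eS'.
- exact: inS.
Qed.

Lemma ramsey_propbP (s k n : nat) : reflect (ramsey_prop s k n) (ramsey_propb s k n).
Proof.
by rewrite /ramsey_propb; case: ClassicalEpsilon.excluded_middle_informative => h; constructor.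
Qed.

(** [finite_ramsey] rules out the fallback value of [ramsey], so a lower bound only needs failure at
    every size up to [N]. *)
Lemma ltn_ramsey (s k N : nat) :
  (forall n, n <= N -> ~ ramsey_prop s k n) -> N < ramsey s k.
Proof.
move=> h; rewrite /ramsey; case: ClassicalEpsilon.excluded_middle_informative => [H|[]].
  case: ex_minnP => m /ramsey_propbP hm _.
  by rewrite ltnNge; apply/negP => /h.
exists (2 ^ (s + k)); apply/ramsey_propbP => e [eI eS].
have [|S [_ hS]] := @finite_ramsey _ e s k setT eI eS; first by rewrite cardsT card_ord.
by case: hS => hS; [left | right]; exists S.
Qed.

(** * Counting orthogonal vectors over a finite field *)

Lemma card_kernel (F : finFieldType) (m n : nat) (M : 'M[F]_(m, n)) :
  #|[set a : 'rV[F]_m | a *m M == 0]%R| * #|F| ^ \rank M = #|F| ^ m.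
Proof.
have -> : [set a : 'rV[F]_m | a *m M == 0]%R = rowg (kermx M).
  by apply/setP => a; rewrite !inE sub_kermx.
by rewrite card_rowg mxrank_ker -expnD subnK // rank_leq_row.
Qed.

Definition dot (F : fieldType) (n : nat) (a b : 'rV[F]_n) : F :=
  ((a *m b^T) 0 0)%R.

Lemma dot_eq0 (F : fieldType) (n : nat) (a b : 'rV[F]_n) :
  (dot a b == 0)%R = (a *m b^T == 0)%R.
Proof.
apply/eqP/eqP => [h|h]; last by rewrite /dot h mxE.
by apply/matrixP => i j; rewrite !ord1 [RHS]mxE.
Qed.

Lemma card_perp (F : finFieldType) (n : nat) (b : 'rV[F]_n) :
  b != 0%R -> #|[set a | dot a b == 0]%R| * #|F| = #|F| ^ n.
Proof.
move=> b0; rewrite -(card_kernel b^T) mxrank_tr rank_rV b0 expn1.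
by congr (_ * _); apply: eq_card => a; rewrite !inE dot_eq0.
Qed.

Lemma card_perp2 (F : finFieldType) (n : nat) (b c : 'rV[F]_n) :
  b != 0%R -> ~~ (c <= b)%MS ->
  #|[set a | (dot a b == 0) && (dot a c == 0)]%R| * #|F| ^ 2 <= #|F| ^ n.
Proof.
move=> b0 cb; have F0 : 0 < #|F| by rewrite (cardD1 0%R).
rewrite -(card_kernel (row_mx b^T c^T)) leq_mul //.
  apply/subset_leq_card/subsetP => a; rewrite !inE !dot_eq0 mul_mx_row.
  by move=> /andP[/eqP-> /eqP->]; rewrite row_mx0.
rewrite leq_pexp2l // -tr_col_mx mxrank_tr.
have lt : (b < b + c)%MS.
  by rewrite /ltmx addsmxSl addsmx_sub submx_refl.
by move: lt; rewrite ltmxErank rank_rV b0 !addsmxE => /andP[].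
Qed.

Lemma card_line (F : finFieldType) (n : nat) (b : 'rV[F]_n) :
  #|[set c : 'rV[F]_n | (c <= b)%MS]| <= #|F|.
Proof.
have F0 : 0 < #|F| by rewrite (cardD1 0%R).
have -> : [set c : 'rV[F]_n | (c <= b)%MS] = rowg b.
  by apply/setP => c; rewrite !inE.
by rewrite card_rowg -[leqRHS]expn1 leq_pexp2l // rank_leq_row.
Qed.

(** * First and second moments of orthogonal sections *)

Definition perp (F : finFieldType) (n : nat) (a : 'rV[F]_n) : {set 'rV[F]_n} :=
  [set b | dot a b == 0]%R.

Lemma card_capE (T : finType) (A B : {set T}) :
  #|A :&: B| = \sum_(b in A) (b \in B : nat).
Proof.
rewrite -sum1_card big_mkcond [RHS]big_mkcond; apply: eq_bigr => b _.
by rewrite inE; case: (b \in A); case: (b \in B).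
Qed.

(** Double counting: each nonzero [b] is orthogonal to a proportion [1/q] of all [a]. *)
Lemma sum_perp (F : finFieldType) (n : nat) (T : {set 'rV[F]_n}) :
  0%R \notin T ->
  (\sum_(a : 'rV[F]_n) #|T :&: perp a|) * #|F| = #|T| * #|F| ^ n.
Proof.
move=> T0; under eq_bigr do rewrite card_capE.
rewrite exchange_big big_distrl -sum_nat_const /=; apply: eq_bigr => b bT.
have b0 : b != 0%R by apply: contraNneq T0 => <-.
rewrite -(card_perp b0); congr (_ * _); rewrite -sum1_card [RHS]big_mkcond.
by apply: eq_bigr => a _; rewrite !inE; case: eqP.
Qed.

(** The square counts pairs [b, c] in [T] orthogonal to [a]. Independent pairs have at most
    [q^(n-2)] common [a]; the at most [q] multiples of each [b] contribute up to [q^(n-1)] each,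
    which is the error term. *)
Lemma sum_perp_sqr (F : finFieldType) (n : nat) (T : {set 'rV[F]_n}) :
  0%R \notin T ->
  (\sum_(a : 'rV[F]_n) #|T :&: perp a| ^ 2) * #|F| ^ 2
    <= #|T| ^ 2 * #|F| ^ n + #|T| * #|F| ^ n.+2.
Proof.
move=> T0; set q := #|F|.
pose N (b c : 'rV[F]_n) := #|[set a | (dot a b == 0) && (dot a c == 0)]%R|.
have -> : \sum_(a : 'rV[F]_n) #|T :&: perp a| ^ 2
    = \sum_(b in T) \sum_(c in T) N b c.
  have cE (a : 'rV[F]_n) : #|T :&: perp a| ^ 2
      = \sum_(b in T) \sum_(c in T) (b \in perp a : nat) * (c \in perp a).
    rewrite expnS expn1 {1}card_capE big_distrl; apply: eq_bigr => b _ /=.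
    by rewrite card_capE big_distrr.
  rewrite (eq_bigr _ (fun a _ => cE a)).
  rewrite exchange_big; apply: eq_bigr => b bT /=.
  rewrite exchange_big; apply: eq_bigr => c cT /=.
  rewrite /N -sum1_card [RHS]big_mkcond; apply: eq_bigr => a _.
  by rewrite !inE; do 2!case: eqP.
rewrite big_distrl /= [#|T| ^ 2]expnS expn1 -mulnA -mulnDr -sum_nat_const.
apply: leq_sum => b bT; have b0 : b != 0%R by apply: contraNneq T0 => <-.
rewrite (bigID (fun c => (c <= b)%MS)) /= mulnDl addnC leq_add //.
  rewrite big_distrl -sum_nat_const /= big_mkcondr.
  by apply: leq_sum => c cT; case: ifP => // cb; apply: card_perp2.
apply: leq_trans (_ : (q * (q ^ n.-1)) * q ^ 2 <= _); last first.
  (* The truncation in [n.-1] is harmless: dimension 0 has no nonzero [b]. *)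
  case: (n) b b0 {T T0 N bT} => [|j] b b0 /=; last by rewrite -expnS -expnD addn2.
  by case/negP: b0; apply/eqP/matrixP => i [].
rewrite leq_mul2r; apply/orP; right.
apply: leq_trans (_ : #|[set c : 'rV[F]_n | (c <= b)%MS]| * q ^ n.-1 <= _).
  rewrite -sum_nat_const big_mkcond [leqRHS]big_mkcond; apply: leq_sum => c _.
  rewrite inE; case: (c \in T) => //=; case: ifP => // _.
  apply: leq_trans (_ : #|[set a | dot a b == 0]%R| <= _).
    by apply/subset_leq_card/subsetP => a; rewrite !inE => /andP[].
  have F0 : 0 < q by rewrite /q (cardD1 0%R).
  rewrite -(leq_pmul2r F0) card_perp // -expnSr.
  case: (n) b b0 {T T0 N bT} => [|j] b b0 //=.
by rewrite leq_mul2r card_line orbT.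
Qed.

(** The average section of [T] has [#|T| / q] elements; bad means below half of that. *)
Definition bad (F : finFieldType) (n : nat) (T : {set 'rV[F]_n}) :=
  [set a : 'rV[F]_n | 2 * #|F| * #|T :&: perp a| < #|T|].

(** Pointwise Chebyshev [1[2x < y] y^2 <= 4 (x - y)^2], rearranged to avoid subtraction in [nat]. *)
Lemma sqr_dev (x y : nat) :
  (if 2 * x < y then 1 else 0) * y ^ 2 + 8 * (y * x) <= 4 * x ^ 2 + 4 * y ^ 2.
Proof.
case: ltnP => h; last by have := (nat_Cauchy x y).1; rewrite mul0n -!mulnn; lia.
have [d ->] : exists d, y = 2 * x + d by exists (y - 2 * x); lia.
by rewrite -!mulnn; lia.
Qed.

(* Chebyshev's inequality for [#|T :&: perp a|] with [a] uniform in [V]. *)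
Lemma card_bad (F : finFieldType) (n : nat) (T : {set 'rV[F]_n}) :
  0%R \notin T -> #|bad T| * #|T| <= 4 * #|F| ^ n.+2.
Proof.
move=> T0; have [->|t0] := posnP #|T|; first by rewrite muln0.
have h1 := sum_perp T0; have h2 := sum_perp_sqr T0.
set q := #|F| in h1 h2 *; set t := #|T| in h1 h2 t0 *.
pose c a := #|T :&: perp a|.
(* [sqr_dev] summed over [a], with [x = q * c a] and [y = t]. *)
have key : #|bad T| * t ^ 2 + 8 * q * t * (\sum_a c a)
    <= 4 * (q ^ 2 * (\sum_a c a ^ 2)) + 4 * t ^ 2 * q ^ n.
  have -> : q ^ n = \sum_(a : 'rV[F]_n) 1 by rewrite sum1_card card_mx mul1n.
  rewrite -sum1_card big_mkcond !big_distrr !big_distrl /= -!big_split /=.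
  apply: leq_sum => a _; rewrite inE -/q -/t -/(c a).
  have -> : 8 * q * t * c a = 8 * (t * (q * c a)) by ring.
  by rewrite -(mulnA 2) -expnMn muln1; apply: sqr_dev.
rewrite -(leq_pmul2r t0).
move: key h1 h2; rewrite -/c; move: (\sum_a c a) (\sum_a c a ^ 2) => S S2.
move: (q ^ n) (q ^ n.+2) => Q Q2 key h1 h2.
have e : 8 * q * t * S = 8 * (t ^ 2 * Q) by rewrite -mulnn -!mulnA -h1; ring.
by move: key; rewrite e [q ^ 2 * _]mulnC -!mulnn => key; rewrite -!mulnn in h2; lia.
Qed.

(** * Words and elementary estimates *)

(** Models [n] independent draws from [s]: probabilities become counts over this list. *)
Fixpoint words (A : Type) (s : seq A) (n : nat) : seq (seq A) :=
  if n is n'.+1 then [seq w :: l | w <- s, l <- words s n'] else [:: [::]].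

Lemma size_words (A : Type) (s : seq A) (n : nat) :
  size (words s n) = size s ^ n.
Proof. by elim: n => //= n IHn; rewrite size_allpairs IHn expnS. Qed.

Lemma mem_words (A : eqType) (s : seq A) (n : nat) (l : seq A) :
  l \in words s n -> size l = n /\ {subset l <= s}.
Proof.
elim: n l => [|n IHn] l /=; first by rewrite inE => /eqP->.
case/allpairsP => -[w l'] /= [ws l'n ->]; have [<- sub] := IHn _ l'n.
by split=> // x; rewrite inE => /predU1P[->|/sub].
Qed.

Lemma count_words (A : Type) (s : seq A) (n : nat) (p : pred (seq A)) :
  count p (words s n.+1) = \sum_(w <- s) count (fun l => p (w :: l)) (words s n).
Proof.
rewrite -sum1_count big_mkcond big_allpairs_dep; apply: eq_bigr => w _.
by rewrite -big_mkcond sum1_count.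
Qed.

Lemma leq_expW (a b j : nat) : a <= b -> a ^ j <= b ^ j.
Proof. by case: j => // j ab; rewrite leq_exp2r. Qed.

(** Combines [C(n,k) k! <= n^k] with [k^k <= 4^k k!]; the latter holds since [k^k] is at most the
    falling factorial [C(2k,k) k!]. *)
Lemma bin_le_pow (n k : nat) : 'C(n, k) * k ^ k <= (4 * n) ^ k.
Proof.
have ffact_le m j : m ^_ j <= m ^ j.
  elim: j m => // j IHj [|m] //; rewrite ffactnS expnS leq_mul //=.
  by apply: leq_trans (IHj m) _; exact: leq_expW.
have bin_le m j : 'C(m, j) <= 2 ^ m.
  by elim: m j => [|m IHm] [|j] //; rewrite ?bin0 ?expn_gt0 // binS expnS mul2n -addnn leq_add.
have pow_le : k ^ k <= 4 ^ k * k`!.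
  apply: leq_trans (_ : (k + k) ^_ k <= _).
    have h j i : j ^ i <= (j + i) ^_ i.
      elim: i => // i IHi; rewrite addnS ffactnS expnS leq_mul //; lia.
    exact: h.
  by rewrite -bin_ffact leq_mul // (leq_trans (bin_le _ _)) // addnn -mul2n expnM.
rewrite expnMn; apply: leq_trans (_ : 'C(n, k) * (4 ^ k * k`!) <= _).
  by rewrite leq_mul.
by rewrite mulnCA bin_ffact leq_mul.
Qed.

(** Bernoulli's inequality gives [(1 - 1/(2q))^(2q) <= 1/2]; raise it to the power [e]. *)
Lemma pow_ratio (q e : nat) : 0 < q ->
  (2 * q - 1) ^ (2 * q * e) * 2 ^ e <= (2 * q) ^ (2 * q * e).
Proof.
move=> q0; rewrite !(expnM _ (2 * q)) -expnMn; apply: leq_expW.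
set x := 2 * q - 1; have -> : 2 * q = x.+1 by lia.
rewrite mulnC mulSn mul1n.
have h j : x ^ j + j * x ^ j.-1 <= x.+1 ^ j.
  elim: j => // -[|j] IHj; first by rewrite !expn1 expn0; lia.
  by move: IHj; rewrite /= !expnS; nia.
apply: leq_trans (h x.+1); rewrite /= leq_add2l expnS; lia.
Qed.

(** * Counting sequences with a free subsequence *)

(* [l] contains [k] pairs, in order, whose second vectors lie in [T] and are not
   orthogonal to the first vector of any earlier chosen pair. *)
Fixpoint has_free (F : finFieldType) (n : nat) (T : {set 'rV[F]_n}) (k : nat)
    (l : seq ('rV[F]_n * 'rV[F]_n)) {struct l} : bool :=
  match k, l with
  | 0, _ => true
  | _.+1, [::] => false
  | k'.+1, p :: l' =>
      has_free T k l' || (p.2 \in T) && has_free (T :\: perp p.1) k' l'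
  end.

(** The subsequence dictates one branch of the recursion; this is how [has_free] detects independent
    sets. *)
Lemma has_free_subseq (F : finFieldType) (n : nat) (T : {set 'rV[F]_n})
    (l' l : seq ('rV[F]_n * 'rV[F]_n)) :
  subseq l' l -> all (fun p => p.2 \in T) l' ->
  pairwise (fun p p' => dot p.1 p'.2 != 0%R) l' -> has_free T (size l') l.
Proof.
elim: l l' T => [|p l IHl] [|p' l'] T //=.
case: eqP => [-> sub /andP[pT lT] /andP[pl pw]|_ sub pT pw]; last first.
  by rewrite (IHl (p' :: l')).
apply/orP; right; rewrite pT IHl //.
apply/allP => x xl; rewrite !inE (allP lT) // andbT.
exact: (allP pl).
Qed.

Definition nonorthogonal_pairs (F : finFieldType) (n : nat) :
    {set 'rV[F]_n * 'rV[F]_n} :=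
  [set p | dot p.1 p.2 != 0]%R.

(** At least half of all [b] are nonzero, and each of these admits at least half of all [a]. *)
Lemma card_nonorthogonal_pairs (F : finFieldType) (n : nat) :
  0 < n -> #|F| ^ (2 * n) <= 4 * #|nonorthogonal_pairs F n|.
Proof.
move=> n0; set q := #|F|.
have q2 : 1 < q by apply: card_finNzRing_gt1.
have -> : #|nonorthogonal_pairs F n|
    = \sum_(b : 'rV[F]_n) #|[set a | dot a b != 0]%R|.
  rewrite -sum1_card big_mkcond /=.
  transitivity (\sum_(a : 'rV[F]_n) \sum_(b : 'rV[F]_n)
      if (a, b) \in nonorthogonal_pairs F n then 1 else 0).
    by rewrite pair_bigA; apply: eq_bigr => -[a b].
  rewrite exchange_big; apply: eq_bigr => b _.
  by rewrite -sum1_card [RHS]big_mkcond; apply: eq_bigr => a _; rewrite !inE.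
have lb (b : 'rV[F]_n) : b != 0%R -> q ^ n <= 2 * #|[set a | dot a b != 0]%R|.
  move=> /card_perp; rewrite -/q.
  have := cardsC [set a | dot a b == 0]%R; rewrite card_mx mul1n -/q.
  have -> : ~: [set a | dot a b == 0]%R = [set a | dot a b != 0]%R.
    by apply/setP => a; rewrite !inE.
  nia.
have cV : #|[pred b : 'rV[F]_n | b != 0%R]| = q ^ n - 1.
  by rewrite -[#|_|]/#|predC1 (0%R : 'rV[F]_n)| cardC1 card_mx mul1n subn1.
apply: leq_trans (_ : 2 * ((q ^ n - 1) * q ^ n) <= _).
  have : q <= q ^ n by rewrite -[leqLHS]expn1 leq_exp2l.
  rewrite mul2n -addnn expnD; nia.
rewrite -cV -sum_nat_const (_ : 4 = 2 * 2) // -mulnA leq_mul2l /=.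
by rewrite big_distrr big_mkcond; apply: leq_sum => b _; rewrite inE; case: ifP => // /lb.
Qed.

(** Bad [a] give at most [4 q^(n+2)] pairs of full weight. The others give at most
    [q^(2n) = q^(n+2) q^(n-2)] pairs, whose weight is smaller by [q^(n-2)]. Hence [5 = 4 + 1]. *)
Lemma sum_weight (F : finFieldType) (n g : nat) (T : {set 'rV[F]_n}) :
  1 < n -> 0%R \notin T ->
  \sum_(w in nonorthogonal_pairs F n | w.2 \in T)
     #|F| ^ ((n - 2) * (if w.1 \in bad T then g.+1 else g))
  <= 5 * #|F| ^ n.+2 * #|F| ^ ((n - 2) * g.+1).
Proof.
move=> n1 T0; set q := #|F|.
have q0 : 0 < q by rewrite /q (cardD1 0%R).
pose f (a : 'rV[F]_n) := q ^ ((n - 2) * (if a \in bad T then g.+1 else g)).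
apply: leq_trans (_ : \sum_(a : 'rV[F]_n) \sum_(b in T) f a <= _).
  rewrite pair_big_dep big_mkcond [leqRHS]big_mkcond.
  by apply: leq_sum => -[a b] _ /=; case: (_ \in _); case: (b \in T).
under eq_bigr do rewrite sum_nat_const.
rewrite -big_distrr (bigID (mem (bad T))) /= mulnDr.
rewrite (mulnDl 4 1) mulnDl leq_add //.
  rewrite (eq_bigr (fun=> q ^ ((n - 2) * g.+1))) => [|a aT]; last by rewrite /f aT.
  by rewrite sum_nat_const mulnA leq_mul // mulnC card_bad.
rewrite (eq_bigr (fun=> q ^ ((n - 2) * g))) => [|a aT]; last by rewrite /f (negPf aT).
rewrite sum_nat_const mul1n mulnS !expnD mulnA.
apply: leq_trans (_ : q ^ n * q ^ n * q ^ ((n - 2) * g) <= _).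
  by rewrite leq_mul // leq_mul // (leq_trans (max_card _)) // card_mx mul1n.
by rewrite mulnA leq_mul // -!expnD leq_pexp2l //; lia.
Qed.

(* The hypothesis on [g] says that [T] becomes empty after [g] shrinkings by the
   factor [1 - 1 / (2q)]; a pair that causes such a shrinking is paid for by one
   factor [q^(n-2)] of the last term, any other pair by a factor of [4 q^(n+2)]. *)
Lemma count_has_free (F : finFieldType) (n N k g : nat) (T : {set 'rV[F]_n}) :
  1 < n -> 0%R \notin T -> #|T| * (2 * #|F| - 1) ^ g < (2 * #|F|) ^ g ->
  count (has_free T k) (words (enum (nonorthogonal_pairs F n)) N)
  <= 'C(N, k) * #|nonorthogonal_pairs F n| ^ (N - k)
     * (5 * #|F| ^ n.+2) ^ k * #|F| ^ ((n - 2) * g).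
Proof.
move=> n1; set q := #|F|; set Om := nonorthogonal_pairs F n.
have q0 : 0 < q by rewrite /q (cardD1 0%R).
have M0 : 0 < #|Om|.
  have qn0 : 0 < q ^ (2 * n) by rewrite expn_gt0 q0.
  by have := card_nonorthogonal_pairs F (ltnW n1); rewrite -/q -/Om; lia.
elim: N k g T => [|N IHN] [|k] g T T0 ltT.
- by rewrite bin0 subn0 !expn0 !mul1n /= expn_gt0 q0.
- by [].
- apply: leq_trans (count_size _ _) _.
  by rewrite size_words -cardE bin0 subn0 mul1n muln1 leq_pmulr // expn_gt0 q0.
rewrite count_words big_enum /=.
set B := 'C(N, k) * #|Om| ^ (N - k) * (5 * q ^ n.+2) ^ k.
(* Union bound: the first pair is skipped or chosen. Pascal's rule matches the two sums. *)
apply: leq_trans (_ : \sum_(w in Om) count (has_free T k.+1) (words (enum Om) N)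
   + \sum_(w in Om | w.2 \in T)
       count (has_free (T :\: perp w.1) k) (words (enum Om) N) <= _).
  rewrite big_mkcondr -big_split; apply: leq_sum => w _ /=.
  case: ifP => wT; last by rewrite addn0; apply: sub_count => l /=; rewrite orbF.
  by rewrite -count_predUI leq_addr.
rewrite sum_nat_const binS subSS !mulnDl leq_add //.
  have := IHN k.+1 g T T0 ltT.
  rewrite -(leq_pmul2l M0).
  move=> h; apply: leq_trans h _.
  have [kN|Nk] := ltnP k N; last by rewrite bin_small // !mul0n muln0.
  rewrite -(subnSK kN) (expnS #|Om|).
  move: (_ ^ (N - k.+1)) (_ ^ k.+1) (_ ^ (_ * g)) => x y z.
  by apply: eq_leq; ring.
case: g ltT => [|g] ltT.
  (* With no shrinkings left, the hypothesis forces [T] to be empty. *)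
  rewrite !expn0 muln1 ltnS leqn0 in ltT.
  rewrite big1 // => w /andP[_]; by rewrite (cards0_eq (eqP ltT)) inE.
apply: leq_trans (_ : B * (\sum_(w in Om | w.2 \in T)
     q ^ ((n - 2) * (if w.1 \in bad T then g.+1 else g))) <= _).
  rewrite big_distrr; apply: leq_sum => w _ /=.
  apply: IHN; first by rewrite inE (negPf T0) andbF.
  have := cardsID (perp w.1) T; rewrite inE -/q.
  set x := #|_ :&: _|; set y := #|_ :\: _|; case: (ltnP (2 * q * x)) => h e.
    apply: leq_ltn_trans ltT; rewrite leq_mul2r -e leq_addl orbT //.
  (* Here the first vector is not bad: [T] shrinks and one unit of [g] is spent. *)
  have le : y * (2 * q) <= #|T| * (2 * q - 1) by nia.
  rewrite -(ltn_pmul2l (m := 2 * q)) ?muln_gt0 //; move: ltT.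
  rewrite !expnS; apply: leq_ltn_trans.
  by rewrite mulnA (mulnC _ y) [leqRHS]mulnA leq_mul2r le orbT.
apply: leq_trans (leq_mul (leqnn B) (sum_weight g n1 T0)) _.
by rewrite /B (expnSr (5 * _)) !mulnA.
Qed.

(** * The graph without large cliques or independent sets *)

(** With [G = 2q(nm+1)], [pow_ratio] makes [G] shrinkings empty a set of fewer than [2^(nm+1)]
    vectors, and the bound on [k] makes their cost [q^((n-2)G)] at most [2^k]. The constant is
    [160 = 4 * 2 * 4 * 5], from [bin_le_pow], this cost, the density of nonorthogonal pairs and
    [sum_weight]. *)
Lemma word_without_free (F : finFieldType) (n m N k : nat) :
  1 < n -> #|F| <= 2 ^ m -> m * ((n - 2) * (2 * #|F| * (n * m + 1))) <= k ->
  160 * N < k * #|F| ^ (n - 2) ->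
  exists l, [/\ size l = N, {subset l <= nonorthogonal_pairs F n}
    & ~~ has_free [set b : 'rV[F]_n | b != 0%R] k l].
Proof.
move=> n1; set q := #|F|; set Om := nonorthogonal_pairs F n => qm Gk ltN.
set G := 2 * q * (n * m + 1) in Gk.
have q0 : 0 < q by rewrite /q (cardD1 0%R).
have qn0 j : 0 < q ^ j by rewrite expn_gt0 q0.
set T0 := [set b : 'rV[F]_n | b != 0%R].
have T00 : 0%R \notin T0 by rewrite inE eqxx.
have M0 := card_nonorthogonal_pairs F (ltnW n1); rewrite -/q -/Om in M0.
have k0 : 0 < k by move: ltN; case: (k); rewrite ?mul0n.
have ltG : #|T0| * (2 * q - 1) ^ G < (2 * q) ^ G.
  apply: leq_trans (pow_ratio (n * m + 1) q0); rewrite -/G mulnC ltn_pmul2l; last first.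
    by rewrite expn_gt0; lia.
  apply: leq_ltn_trans (max_card _) _; rewrite card_mx mul1n -/q.
  apply: leq_ltn_trans (_ : 2 ^ (n * m) < _); last by rewrite ltn_exp2l // addn1.
  by rewrite mulnC expnM leq_exp2r // ltnW.
have cnt := count_has_free N k n1 T00 ltG; rewrite -/q -/Om in cnt.
set X := 5 * q ^ n.+2 in cnt.
have lt : count (has_free T0 k) (words (enum Om) N) < size (words (enum Om) N).
  rewrite size_words -cardE; apply: leq_ltn_trans cnt _.
  have Om0 : 0 < #|Om| by have := qn0 (2 * n); lia.
  have MN j : 0 < #|Om| ^ j by rewrite expn_gt0 Om0.
  have [ltNk|kN] := ltnP N k; first by rewrite bin_small // mul0n.
  have -> : #|Om| ^ N = #|Om| ^ (N - k) * #|Om| ^ k by rewrite -expnD subnK.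
  rewrite -!(mulnA 'C(N, k)) mulnCA -!mulnA ltn_pmul2l //.
  (* This factor clears the denominators [k] of [bin_le_pow] and [4] of the density bound. *)
  rewrite -(ltn_pmul2r (m := (4 * k) ^ k)) ?expn_gt0 ?muln_gt0 ?k0 //.
  have YG : q ^ ((n - 2) * G) <= 2 ^ k.
    apply: leq_trans (_ : (2 ^ m) ^ ((n - 2) * G) <= _).
      exact: leq_expW.
    by rewrite -expnM leq_exp2l.
  apply: leq_trans (_ : (4 * #|Om|) ^ k * k ^ k <= _); last first.
    by rewrite !expnMn; apply: eq_leq; ring.
  apply: leq_trans (_ : (k * q ^ (2 * n)) ^ k <= _); last first.
    by rewrite -expnMn (mulnC _ k) leq_expW // leq_mul2l M0 orbT.
  apply: leq_ltn_trans (_ : (160 * N * q ^ n.+2) ^ k < _); last first.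
    rewrite ltn_exp2r // (_ : 2 * n = (n - 2) + n.+2); last by lia.
    by rewrite expnD mulnA ltn_pmul2r.
  have := bin_le_pow N k.
  have -> : (160 * N * q ^ n.+2) = 4 * N * 2 * (4 * X) by rewrite /X; ring.
  rewrite !(expnMn (4 * N * 2)) !(expnMn (4 * N)) (expnMn 4 X) (expnMn 4 k) => h.
  apply: leq_trans (_ : ('C(N, k) * k ^ k) * 2 ^ k * (4 ^ k * X ^ k) <= _).
    rewrite -(mulnA _ (2 ^ k)).
    apply: leq_trans
      (_ : 'C(N, k) * k ^ k * (q ^ ((n - 2) * G) * (4 ^ k * X ^ k)) <= _).
      move: (X ^ k) (4 ^ k) (k ^ k) (q ^ (_ * G)) => x1 x2 x3 x4.
      by apply: eq_leq; ring.
    by rewrite leq_mul2l leq_mul2r YG !orbT.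
  by rewrite leq_mul2r leq_mul2r h !orbT.
have /hasP[l lw hl] : has (predC (has_free T0 k)) (words (enum Om) N).
  by rewrite has_predC all_count neq_ltn lt.
have [sl sub] := mem_words lw.
by exists l; split=> // p /sub; rewrite mem_enum.
Qed.

Lemma pairwise_enum_ord (N : nat) (S : {set 'I_N}) :
  pairwise (fun i j : 'I_N => i < j) (enum S).
Proof.
rewrite -sorted_pairwise; last by move=> i j l; apply: ltn_trans.
rewrite {1}/enum_mem -enumT; apply: sorted_filter; first by move=> i j l; apply: ltn_trans.
by rewrite -(sorted_map (f := val) (e' := ltn)) val_enum_ord iota_ltn_sorted.
Qed.

Lemma not_ramsey_prop (F : finFieldType) (n m N k : nat) :
  1 < n -> #|F| <= 2 ^ m -> m * ((n - 2) * (2 * #|F| * (n * m + 1))) <= k ->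
  160 * N < k * #|F| ^ (n - 2) -> ~ ramsey_prop n.+1 k N.
Proof.
move=> n1 qm Gk ltN; have [l [sl lOm nfree]] := word_without_free n1 qm Gk ltN.
pose w (i : 'I_N) := nth (0, 0)%R l i.
have wOm i : dot (w i).1 (w i).2 != 0%R.
  by have := lOm (w i); rewrite inE; apply; rewrite mem_nth ?sl.
pose e : rel 'I_N := fun i j =>
  (i < j) && (dot (w i).1 (w j).2 == 0%R) || (j < i) && (dot (w j).1 (w i).2 == 0%R).
have se : simple_graph e.
  split=> [i|i j]; first by rewrite /e ltnn.
  by rewrite /e orbC.
have eE (i j : 'I_N) : i < j -> e i j = (dot (w i).1 (w j).2 == 0%R).
  by move=> ij; rewrite /e ij ltnNge (ltnW ij) orbF.
case/(_ e se) => -[S [cS hS]].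
  have pS := pairwise_enum_ord S; have sS : size (enum S) = n.+1 by rewrite -cardE.
  have [i0 _] : exists i, i \in S by apply/card_gt0P; rewrite cS.
  pose s (i : 'I_n.+1) := nth i0 (enum S) i.
  have sS' i : s i \in S by rewrite -mem_enum mem_nth ?sS.
  have sM (i j : 'I_n.+1) : i < j -> s i < s j.
    by move=> ij; apply: (pairwiseP i0 pS); rewrite ?inE ?sS.
  pose A := (\matrix_(i < n.+1) (w (s i)).1)%R.
  pose B := (\matrix_(i < n.+1) (w (s i)).2)%R.
  have ABE i j : ((A *m B^T) i j = dot (w (s i)).1 (w (s j)).2)%R.
    by rewrite /dot !mxE; apply: eq_bigr => x _; rewrite !mxE.
  (* On a clique the product is lower triangular with nonzero diagonal, so its rank [n.+1] exceeds
     the inner dimension [n]. *)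
  have : (A *m B^T)%R \in unitmx.
    rewrite unitmxE GRing.unitfE det_trig.
      by apply/GRing.prodf_neq0 => i _; rewrite ABE.
    apply/is_trig_mxP => i j ij; rewrite ABE; apply/eqP.
    have lt := sM _ _ ij.
    by rewrite -eE //; apply: hS => //; rewrite neq_ltn lt.
  move/mxrank_unit => r; have := mulmx_max_rank A B^T%R.
  by rewrite r ltnn.
case/negP: nfree; rewrite -cS.
have lE : l = [seq w i | i <- enum 'I_N].
  rewrite -[LHS](mkseq_nth (0, 0)%R) /mkseq sl -val_enum_ord -map_comp.
  by apply: eq_map.
have -> : #|S| = size [seq w i | i <- enum S] by rewrite size_map -cardE.
apply: has_free_subseq.
- rewrite lE; apply: map_subseq; rewrite {1}/enum_mem -enumT; exact: filter_subseq.
- apply/allP => p /mapP[i _ ->]; rewrite inE.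
  by apply: contraNneq (wOm i) => ->; rewrite dot_eq0 trmx0 mulmx0.
rewrite pairwise_map; move: (pairwise_enum_ord S).
apply: (sub_in_pairwise (P := mem S)); last by apply/allP => i; rewrite mem_enum.
by move=> i j iS jS /= ij; rewrite -eE //; apply: hS.
Qed.

(** * Choice of the field size *)

Lemma ramsey_lower (s m k : nat) :
  3 < s -> 0 < m -> 2 * (s - 3) * s * 2 ^ m * m ^ 2 <= k ->
  k * (2 ^ m) ^ (s - 3) <= 160 * ramsey s k.
Proof.
move=> s3 m0 mk; have [F _ cF] := pPrimePowerField (isT : prime 2) m0.
case: s s3 mk => // n n2 mk; rewrite leqNgt; apply/negP => ltR.
(* If the bound failed, [not_ramsey_prop] would apply to every size up to [ramsey n.+1 k] itself. *)
have : ramsey n.+1 k < ramsey n.+1 k; last by rewrite ltnn.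
apply: ltn_ramsey => N leN; apply: (@not_ramsey_prop F n m); rewrite ?cF //.
- exact: ltnW.
- apply: leq_trans mk; rewrite subSS -!mulnn.
  have : n * m + 1 <= n.+1 * m by lia.
  move: (n - 2) (2 ^ m) (n * m + 1) => t q x h.
  apply: leq_trans (_ : m * (t * (2 * q * (n.+1 * m))) <= _); last by apply: eq_leq; ring.
  by rewrite !leq_mul.
- by rewrite subSS in ltR; apply: leq_ltn_trans ltR; rewrite leq_mul2l leN orbT.
Qed.

(** Take the largest [m] meeting the lower constraint; passing to [m.+1] costs a factor 2 from
    [2 ^ m] and at most 4 from [m ^ 2]. *)
Lemma dyadic_scale (c k : nat) : 0 < c -> 2 * c <= k ->
  exists m, [/\ 0 < m, c * 2 ^ m * m ^ 2 <= k & k <= 8 * c * 2 ^ m * m ^ 2].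
Proof.
move=> c0 ck; pose P m := c * 2 ^ m * m ^ 2 <= k.
have P1 : P 1 by rewrite /P; lia.
have Pb m : P m -> m <= k.
  rewrite /P; case: m => // m; apply: leq_trans; rewrite -mulnn.
  have q0 : 0 < 2 ^ m.+1 by rewrite expn_gt0.
  by rewrite mulnA leq_pmull // !muln_gt0 c0 q0.
case: (ex_maxnP (ex_intro P 1 P1) Pb) => m Pm max; have m0 := max _ P1.
exists m; split=> //; have : ~~ P m.+1 by apply/negP => /max; rewrite ltnn.
rewrite /P -ltnNge => /ltnW h; apply: leq_trans h _.
rewrite expnS -!mulnn; move: (2 ^ m) => q.
have : m.+1 * m.+1 <= 4 * (m * m) by nia.
move: (m.+1 * m.+1) (m * m) => x y xy.
by apply: leq_trans (leq_mul (leqnn _) xy) _; apply: eq_leq; ring.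
Qed.

Lemma ramsey_gt0 (s k : nat) : 0 < s -> 0 < k -> 0 < ramsey s k.
Proof.
move=> s0 k0; apply: ltn_ramsey => n; rewrite leqn0 => /eqP-> h.
have card0 (S : {set 'I_0}) : #|S| = 0.
  by apply/eqP; rewrite -leqn0 (leq_trans (max_card _)) // card_ord.
have [//|[S [cS _]]|[S [cS _]]] := h (fun _ _ => false).
  by rewrite -cS card0 in s0.
by rewrite -cS card0 in k0.
Qed.

(* Passage to the real bound with logarithms *)
From Stdlib Require Import Reals Lra.
Open Scope R_scope.

Lemma INR_expn (a b : nat) : INR (expn a b) = INR a ^ b.
Proof. by elim: b => //= b IHb; rewrite expnS -multE mult_INR IHb. Qed.



Lemma ln_nondecreasing (x y : R) : 0 < x -> x <= y -> ln x <= ln y.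
Proof. by move=> x0 [xy|->]; [left; apply: ln_increasing | right]. Qed.

(** From [2^m <= k] and [ln 2 > 1/2] follows [m <= 2 ln k], so the upper bound on [k] yields
    [2^m >= k / (32 c (ln k)^2)]. *)
Lemma ramsey_lower_real (c t k m r : nat) :
  (0 < c)%nat -> (2 <= k)%nat ->
  (0 < m)%nat -> (c * expn 2 m * expn m 2 <= k)%nat ->
  (k <= 8 * c * expn 2 m * expn m 2)%nat ->
  (k * expn (expn 2 m) t <= 160 * r)%nat ->
  INR k * (INR k / ln (INR k) ^ 2) ^ t <= 160 * (32 * INR c) ^ t * INR r.
Proof.
move=> c0 k2 m0 lo up bnd.
have C0 : 1 <= INR c by apply: (le_INR 1); apply/leP.
have K2 : 2 <= INR k by apply: (le_INR 2); apply/leP.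
have L0 : 0 < ln (INR k) by rewrite -ln_1; apply: ln_increasing; lra.
have q0 : 0 < 2 ^ m by apply: pow_lt; lra.
have mL : INR m <= 2 * ln (INR k).
  have qk : 2 ^ m <= INR k.
    rewrite -[2]/(INR 2) -INR_expn; apply/le_INR/leP; apply: leq_trans lo.
    by rewrite mulnAC leq_pmull // muln_gt0 c0 expn_gt0 m0.
  have : ln (2 ^ m) <= ln (INR k) by apply: ln_nondecreasing.
  rewrite ln_pow; last by lra.
  by have := ln_lt_2; have := pos_INR m; nra.
have kq : INR k / ln (INR k) ^ 2 <= 32 * INR c * 2 ^ m.
  apply: (Rmult_le_reg_r (ln (INR k) ^ 2)); first by apply: pow_lt.
  rewrite /Rdiv Rmult_assoc Rinv_l ?Rmult_1_r; last by apply: pow_nonzero; lra.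
  move/leP/le_INR: up; rewrite -!multE !mult_INR !INR_expn -[INR 2]/2 => up.
  have -> : 32 * INR c * 2 ^ m * ln (INR k) ^ 2
      = INR 8 * INR c * 2 ^ m * (2 * ln (INR k)) ^ 2 by rewrite /=; lra.
  apply: Rle_trans up _; apply: Rmult_le_compat_l.
    by apply: Rmult_le_pos; [rewrite /=; nra | lra].
  by have := pos_INR m; rewrite /=; nra.
have -> : 160 * (32 * INR c) ^ t * INR r = (32 * INR c) ^ t * (160 * INR r) by lra.
move/leP/le_INR: bnd; rewrite -!multE !mult_INR !INR_expn -[INR 2]/2.
have -> : INR 160 = 160 by rewrite INR_IZR_INZ.
move=> bnd; apply: Rle_trans (_ : INR k * (32 * INR c * 2 ^ m) ^ t <= _).
  apply: Rmult_le_compat_l; first by lra.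
  apply: pow_incr; split=> //; apply: Rle_mult_inv_pos; first by lra.
  exact: pow_lt.
rewrite Rpow_mult_distr; have : 0 <= (32 * INR c) ^ t by apply: pow_le; lra.
by move=> h; have := Rmult_le_compat_l _ _ _ h bnd; lra.
Qed.

Theorem theorem1p1 :
  forall s : nat, (4 <= s)%nat ->
  exists c : R, 0 < c /\
    forall k : nat, (2 <= k)%nat ->
      c * (INR k ^ (s - 2)%nat) / (ln (INR k) ^ (2 * s - 6)%nat)
        <= INR (ramsey s k).
Proof.
move=> s s4; pose t := (s - 3)%nat; pose C := (2 * (s - 3) * s)%nat.
have C0 : (0 < C)%nat by rewrite /C; lia.
have C1 : 1 <= INR C by apply: (le_INR 1); apply/leP.
have D0 j : 0 < (32 * INR C) ^ j by apply: pow_lt; lra.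
(* Large [k] yields the exponent [t]; the extra factor [32 * INR C] lets the trivial bound
   [ramsey s k >= 1] cover [k < 2 * C]. *)
exists (/ (160 * (32 * INR C) ^ t.+1)); split.
  by apply: Rinv_0_lt_compat; have := D0 t.+1; lra.
move=> k k2.
have K2 : 2 <= INR k by apply: (le_INR 2); apply/leP.
have L2 : / 2 < ln (INR k).
  apply: Rlt_le_trans ln_lt_2 _; apply: ln_nondecreasing; lra.
have LL0 : 0 < ln (INR k) ^ 2 by apply: pow_lt; lra.
have -> : / (160 * (32 * INR C) ^ t.+1) * INR k ^ (s - 2)%nat / ln (INR k) ^ (2 * s - 6)%nat
    = INR k * (INR k / ln (INR k) ^ 2) ^ t / (160 * (32 * INR C) ^ t.+1).
  have -> : (s - 2)%nat = t.+1 by rewrite /t; lia.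
  have -> : (2 * s - 6)%nat = (2 * t)%coq_nat by rewrite /t; lia.
  by rewrite /Rdiv (Rpow_mult_distr (INR k)) pow_inv -pow_mult -(tech_pow_Rmult (INR k)); lra.
have R1 : 1 <= INR (ramsey s k).
  apply: (le_INR 1); apply/leP.
  by apply: ramsey_gt0; [apply: leq_trans s4 | apply: leq_trans k2].
apply: (Rmult_le_reg_r (160 * (32 * INR C) ^ t.+1)); first by have := D0 t.+1; lra.
rewrite /Rdiv Rmult_assoc Rinv_l ?Rmult_1_r; last by have := D0 t.+1; lra.
have [kC|Ck] := ltnP k (2 * C).
  have kR : INR k <= 2 * INR C.
    by move/ltnW/leP/le_INR: kC; rewrite -multE mult_INR.
  have kL : INR k / ln (INR k) ^ 2 <= 32 * INR C.
    apply: (Rmult_le_reg_r (ln (INR k) ^ 2)) => //.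
    rewrite /Rdiv Rmult_assoc Rinv_l ?Rmult_1_r; last by lra.
    have LL4 : / 4 <= ln (INR k) ^ 2 by rewrite /=; nra.
    by nra.
  apply: Rle_trans (_ : 32 * INR C * (32 * INR C) ^ t <= _); last first.
    by have := D0 t.+1; rewrite /=; nra.
  apply: Rmult_le_compat; try lra.
    by apply: pow_le; apply: Rle_mult_inv_pos; lra.
  apply: pow_incr; split=> //; apply: Rle_mult_inv_pos; lra.
have [m [m0 lo up]] := dyadic_scale C0 Ck.
have bnd := ramsey_lower s4 m0 lo.
apply: Rle_trans (ramsey_lower_real C0 k2 m0 lo up bnd) _.
rewrite -/t /=; have XR : 0 <= (32 * INR C) ^ t * INR (ramsey s k).
  by apply: Rmult_le_pos; [apply/Rlt_le/D0 | lra].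
by nra.
Qed.
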